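(* Let $M$ be a monoid, with submonoids, posets $\mathscr L(M)\subseteq\mathscr L^+(M)$ and type $\mathsf T(M)=(t_1,t_2,t_3,t_4)$ as defined in the context. (a) If $t_1=1$ or $t_3=1$, then $\mathscr L^+(M)=\mathscr L(M)$. (b) If $\mathsf T(M)=(0,i,0,j)$ with $i,j\in\{0,1\}$, then among the fifteen names $\{1\},Q,E,G,G_L,G_R,P,P_L,P_R,G_{LR},F,F_L,F_R,F_{LR},M$ the only coincidences are: $M=F_{LR}$ exactly when $i=1$; and $G=\{1\}$, $P=Q$, $F=E$, these three holding exactly when $j=1$. The inclusion order on $\mathscr L^+(M)$ is the reflexive-transitive closure of the inclusions $\{1\}\subseteq G$, $\{1\}\subseteq Q$, $Q\subseteq E$, $Q\subseteq P$, $E\subseteq F$, $G\subseteq G_L$, $G\subseteq G_R$, $G\subseteq P$, $G_L\subseteq P_L$, $G_R\subseteq P_R$, $P\subseteq P_L$, $P\subseteq P_R$, $P\subseteq F$, $P_L\subseteq G_{LR}$, $P_R\subseteq G_{LR}$, $P_L\subseteq F_L$, $P_R\subseteq F_R$, $F\subseteq F_L$, $F\subseteq F_R$, $F_L\subseteq F_{LR}$, $F_R\subseteq F_{LR}$, $G_{LR}\subseteq F_{LR}$, $F_{LR}\subseteq M$.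
   Context: Submonoids of a monoid $M$ contain its identity $1$; $\langle A\rangle$ denotes the submonoid generated by $A$. An element $x\in M$ is a left unit if $ax=1$ for some $a\in M$, a right unit if $xa=1$ for some $a\in M$. For every monoid $M$ define: $\mathbb E(M)$, generated by all idempotents of $M$; $\mathbb G_L(M)$, the set of left units; $\mathbb G_R(M)$, the set of right units; $\mathbb G(M)=\mathbb G_L(M)\cap\mathbb G_R(M)$; $\mathbb G_{LR}(M)=\langle\mathbb G_L(M)\cup\mathbb G_R(M)\rangle$; $\mathbb F(M)=\langle\mathbb E(M)\cup\mathbb G(M)\rangle$; $\mathbb F_L(M)=\langle\mathbb E(M)\cup\mathbb G_L(M)\rangle$; $\mathbb F_R(M)=\langle\mathbb E(M)\cup\mathbb G_R(M)\rangle$; $\mathbb F_{LR}(M)=\langle\mathbb E(M)\cup\mathbb G_L(M)\cup\mathbb G_R(M)\rangle$. For fixed $M$ abbreviate these by $E,G_L,G_R,G,G_{LR},F,F_L,F_R,F_{LR}$ respectively, and set $Q=\mathbb E(G_{LR})$, $P=\mathbb F(G_{LR})$, $P_L=\mathbb F_L(G_{LR})$, $P_R=\mathbb F_R(G_{LR})$ (each operator applied to the monoid $G_{LR}$). Let $\mathscr L(M)=\{\{1\},E,G,G_L,G_R,G_{LR},F,F_L,F_R,F_{LR},M\}$ and $\mathscr L^+(M)=\mathscr L(M)\cup\{Q,P,P_L,P_R\}$, both ordered by inclusion. The type $\mathsf T(M)=(t_1,t_2,t_3,t_4)\in\{0,1\}^4$ is defined by: $t_1=1$ iff $G=G_L$;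 $t_2=1$ iff $F_{LR}=M$; $t_3=1$ iff $F_{LR}=G_{LR}$; $t_4=1$ iff $G=\{1\}$. *)

(* Defs.v *)
From HB Require Import structures.
From mathcomp Require Import all_boot.
From mathcomp Require Import boolp classical_sets.
From Stdlib Require Import Relation_Operators.

Set Implicit Arguments.
Unset Strict Implicit.
Unset Printing Implicit Defensive.

Local Open Scope group_scope.
Local Open Scope classical_set_scope.

(* A [monoidType] also carries a choice operator, which every type has
   classically (see [boolp]); [M] is otherwise an arbitrary monoid. *)

Section Operators.
Variable M : monoidType.

Definition is_submonoid (A : set M) : Prop :=
  A 1 /\ (forall x y, A x -> A y -> A (x * y)).

Definition gen (A : set M) : set M := smallest is_submonoid A.

Definition opE : set M := gen [set x | x * x = x].
Definition opGL : set M := [set x | exists a, a * x = 1].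
Definition opGR : set M := [set x | exists a, x * a = 1].
Definition opG : set M := opGL `&` opGR.
Definition opGLR : set M := gen (opGL `|` opGR).
Definition opF : set M := gen (opE `|` opG).
Definition opFL : set M := gen (opE `|` opGL).
Definition opFR : set M := gen (opE `|` opGR).
Definition opFLR : set M := gen (opE `|` opGL `|` opGR).

Lemma gen_submonoid (A : set M) : is_submonoid (gen A).
Proof.
split=> [B [[]]//|x y Ax Ay B BP].
by case: (BP) => -[_ BM] _; apply: BM; [apply: Ax|apply: Ay].
Qed.

Lemma opGLR_closed : monoid_closed (mem opGLR).
Proof.
have [G1 GM] := gen_submonoid (opGL `|` opGR).
split=> [|x y /set_mem Gx /set_mem Gy]; apply/mem_set=> //; exact: GM.
Qed.

(* The submonoid [opGLR] as a monoid in its own right. *)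
Record GLR_monoid : Type :=
  GLRMonoid { GLR_val : M; GLR_valP : GLR_val \in opGLR }.
HB.instance Definition _ := [isSub for GLR_val].
HB.instance Definition _ := [Choice of GLR_monoid by <:].
HB.instance Definition _ :=
  SubChoice_isSubMonoid.Build M (fun x => x \in opGLR) GLR_monoid opGLR_closed.

End Operators.

(* [set M] unfolds to a function type, which would make [M] implicit. *)
Arguments opE M : clear implicits.
Arguments opGL M : clear implicits.
Arguments opGR M : clear implicits.
Arguments opG M : clear implicits.
Arguments opGLR M : clear implicits.
Arguments opF M : clear implicits.
Arguments opFL M : clear implicits.
Arguments opFR M : clear implicits.
Arguments opFLR M : clear implicits.

(* The operators evaluated at the monoid [GLR_monoid M], viewed inside [M]. *)
Definition subQ (M : monoidType) : set M := @GLR_val M @` opE (GLR_monoid M).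
Definition subP (M : monoidType) : set M := @GLR_val M @` opF (GLR_monoid M).
Definition subPL (M : monoidType) : set M := @GLR_val M @` opFL (GLR_monoid M).
Definition subPR (M : monoidType) : set M := @GLR_val M @` opFR (GLR_monoid M).

Arguments subQ M : clear implicits.
Arguments subP M : clear implicits.
Arguments subPL M : clear implicits.
Arguments subPR M : clear implicits.

Definition latL (M : monoidType) : set (set M) :=
  [set [set 1]; opE M; opG M; opGL M; opGR M; opGLR M;
       opF M; opFL M; opFR M; opFLR M; setT].

Arguments latL M : clear implicits.

Definition latLplus (M : monoidType) : set (set M) :=
  latL M `|` [set subQ M; subP M; subPL M; subPR M].

Arguments latLplus M : clear implicits.

Definition typeT (M : monoidType) : bool * bool * bool * bool :=
  (`[< opG M = opGL M >], `[< opFLR M = setT >],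
   `[< opFLR M = opGLR M >], `[< opG M = [set 1] >]).

Inductive name : Type :=
  | n1 | nQ | nE | nG | nGL | nGR | nP | nPL | nPR | nGLR
  | nF | nFL | nFR | nFLR | nM.

Definition den (M : monoidType) (n : name) : set M :=
  match n with
  | n1 => [set 1]
  | nQ => subQ M
  | nE => opE M
  | nG => opG M
  | nGL => opGL M
  | nGR => opGR M
  | nP => subP M
  | nPL => subPL M
  | nPR => subPR M
  | nGLR => opGLR M
  | nF => opF M
  | nFL => opFL M
  | nFR => opFR M
  | nFLR => opFLR M
  | nM => setT
  end.

Arguments den M n : clear implicits.

Inductive coincidence : name -> name -> Prop :=
  | co_M_FLR : coincidence nM nFLR
  | co_G_1 : coincidence nG n1
  | co_P_Q : coincidence nP nQ
  | co_F_E : coincidence nF nE.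

Inductive covering : name -> name -> Prop :=
  | cov_1_G : covering n1 nG
  | cov_1_Q : covering n1 nQ
  | cov_Q_E : covering nQ nE
  | cov_Q_P : covering nQ nP
  | cov_E_F : covering nE nF
  | cov_G_GL : covering nG nGL
  | cov_G_GR : covering nG nGR
  | cov_G_P : covering nG nP
  | cov_GL_PL : covering nGL nPL
  | cov_GR_PR : covering nGR nPR
  | cov_P_PL : covering nP nPL
  | cov_P_PR : covering nP nPR
  | cov_P_F : covering nP nF
  | cov_PL_GLR : covering nPL nGLR
  | cov_PR_GLR : covering nPR nGLR
  | cov_PL_FL : covering nPL nFL
  | cov_PR_FR : covering nPR nFR
  | cov_F_FL : covering nF nFL
  | cov_F_FR : covering nF nFR
  | cov_FL_FLR : covering nFL nFLR
  | cov_FR_FLR : covering nFR nFLR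
  | cov_GLR_FLR : covering nGLR nFLR
  | cov_FLR_M : covering nFLR nM.

(* A relation between submonoids rather than between names: when two names
   denote the same submonoid, their edges are merged. *)
Definition base_incl (M : monoidType) (A B : set M) : Prop :=
  exists n m, [/\ covering n m, A = den M n & B = den M m].

(* Main.v *)
Require Import Defs.
From HB Require Import structures.
From mathcomp Require Import all_boot.
From mathcomp Require Import boolp classical_sets.
From Stdlib Require Import Relation_Operators Operators_Properties.

Set Implicit Arguments.
Unset Strict Implicit.
Unset Printing Implicit Defensive.

(** Write E, G_L, G_R, G, G_LR, F, F_L, F_R, F_LR for the operators on M, and
    Q, P, P_L, P_R for the submonoids that E, F, F_L, F_R cut out of G_LR.

    The monoid G_LR has the same one-sided units as M, because a one-sided
    inverse of a one-sided unit is a one-sided unit on the other side. So Q is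
    generated by the idempotents lying in G_LR, and P, P_L, P_R are generated
    by Q together with G, G_L, G_R ([subQE], [subPE], [subPLE], [subPRE]). If
    G = G_L, then all one-sided units are units and G_LR = G has the single
    idempotent 1; if F_LR = G_LR, then E lies in G_LR, so that Q = E. Either way
    Q, P, P_L, P_R are not new, which is the collapsing case.

    Otherwise the listed inclusions always hold, and the poset they generate
    embeds into a Boolean lattice: a name is determined by which of the six
    members G, Q, E, G_L, G_R, M lie below it, and one name is below another
    iff the same holds for these sets of members ([leN_path]). It is thus
    enough to show that each of the six is contained in no more names than
    listed, that is, to separate it from the largest names not above it:
    - G from E, unless G is trivial;
    - Q from G_L and from G_R;
    - E from G_LR;
    - G_L from F_R and G_R from F_L;
    - M from F_LR, unless the two are equal.
    The separations come from cancelling factors: the last factor of a product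
    that is a left unit is a left unit, and an idempotent left unit is 1. Hence
    E meets G_L only in 1 ([opE_opGL]), and F_R meets G_L only in G
    ([opGL_opFR]); the mirror images are [opE_opGR] and [opGR_opFL]. For Q, a
    left unit x that is not a unit, with a x = 1, yields the nontrivial
    idempotent x a of G_LR ([subQ_trivial]).

    When G is trivial or F_LR = M, the coordinate G or M loses its meaning.
    Without it the remaining ones identify only the pairs of names listed for
    that case ([leN_anti]), and replacing each name by the smaller one of its
    pair turns the coarser order back into the full one ([leN_repr]). *)

Local Open Scope group_scope.
Local Open Scope classical_set_scope.

(** * Generated submonoids *)

Section Generation.
Context {M : monoidType}.
Implicit Types A B : set M.

Lemma gen_sub A B : is_submonoid B -> A `<=` B -> gen A `<=` B.
Proof. by move=> Bsub AB x; apply; split. Qed.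

Lemma sub_gen A : A `<=` gen A.
Proof. exact: sub_gen_smallest. Qed.

Lemma gen1 A : gen A 1.
Proof. by case: (gen_submonoid A). Qed.

Lemma genM A x y : gen A x -> gen A y -> gen A (x * y).
Proof. by case: (gen_submonoid A) => _; apply. Qed.

Lemma gen_mono A B : A `<=` gen B -> gen A `<=` gen B.
Proof. by apply: gen_sub; apply: gen_submonoid. Qed.

Lemma gen_eq A B : A `<=` gen B -> B `<=` gen A -> gen A = gen B.
Proof. by move=> AB BA; apply/seteqP; split; apply: gen_mono. Qed.

Lemma gen_id A : is_submonoid A -> gen A = A.
Proof.
by move=> Asub; apply/seteqP; split; [exact: gen_sub | exact: sub_gen].
Qed.

End Generation.

Lemma image_gen (M N : monoidType) (f : M -> N) (A : set M) :
  f 1 = 1 -> (forall x y, f (x * y) = f x * f y) ->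
  f @` gen A = gen (f @` A).
Proof.
move=> f1 fM; apply/seteqP; split=> [_ [x Ax <-]|].
  suff: gen A `<=` f @^-1` gen (f @` A) by apply.
  apply: gen_sub => [|y Ay]; last by apply: sub_gen; exists y.
  split=> [|y z /= fy fz]; first by rewrite /= f1; apply: gen1.
  by rewrite fM; apply: genM.
apply: gen_sub => [|_ [x Ax <-]]; last by exists x => //; apply: sub_gen.
split=> [|_ _ [x Ax <-] [y Ay <-]]; first by exists 1 => //; apply: gen1.
by exists (x * y); [apply: genM | apply: fM].
Qed.

(** * One-sided units against idempotents *)

Section Units.
Context {M : monoidType}.
Implicit Types x y a : M.

Lemma inv_uniq x a b : a * x = 1 -> x * b = 1 -> a = b.
Proof. by move=> ax xb; rewrite -[a]mulg1 -xb mulgA ax mul1g. Qed.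

Lemma opGL_submonoid : is_submonoid (opGL M).
Proof.
split=> [|x y [a ax] [b by1]]; first by exists 1; rewrite mulg1.
by exists (b * a); rewrite -mulgA (mulgA a) ax mul1g.
Qed.

Lemma opGR_submonoid : is_submonoid (opGR M).
Proof.
split=> [|x y [a xa] [b yb]]; first by exists 1; rewrite mulg1.
by exists (b * a); rewrite -mulgA (mulgA y) yb mul1g.
Qed.

Lemma opG_submonoid : is_submonoid (opG M).
Proof.
have [L1 LM] := opGL_submonoid; have [R1 RM] := opGR_submonoid.
by split=> // x y [Lx Rx] [Ly Ry]; split; [apply: LM | apply: RM].
Qed.

Lemma opGL_mulr x y : opGL M (x * y) -> opGL M y.
Proof. by case=> a axy; exists (a * x); rewrite -mulgA. Qed.

Lemma opGR_mull x y : opGR M (x * y) -> opGR M x.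
Proof. by case=> a xya; exists (y * a); rewrite mulgA. Qed.

Lemma idem_opGL x : x * x = x -> opGL M x -> x = 1.
Proof. by move=> xx [a ax]; rewrite -[x]mul1g -{1}ax -mulgA xx ax. Qed.

Lemma idem_opGR x : x * x = x -> opGR M x -> x = 1.
Proof. by move=> xx [a xa]; rewrite -[x]mulg1 -{1}xa mulgA xx xa. Qed.

(** A right factor of a left unit is a left unit, so the last idempotent of a
    product that is a left unit equals 1 and can be dropped. *)
Lemma opE_opGL : opE M `&` opGL M `<=` [set 1].
Proof.
move=> x [Ex Lx]; suff: opE M `<=` [set y | opGL M y -> y = 1] by apply.
apply: gen_sub => [|y]; last exact: idem_opGL.
split=> // y z IHy IHz Lyz; have z1 := IHz (opGL_mulr Lyz).
by rewrite z1 mulg1 in Lyz *; apply: IHy.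
Qed.

Lemma opE_opGR : opE M `&` opGR M `<=` [set 1].
Proof.
move=> x [Ex Rx]; suff: opE M `<=` [set y | opGR M y -> y = 1] by apply.
apply: gen_sub => [|y]; last exact: idem_opGR.
split=> // y z IHy IHz Ryz; have y1 := IHy (opGR_mull Ryz).
by rewrite y1 mul1g in Ryz *; apply: IHz.
Qed.

(** The last factor of a product of idempotents and right units that is a left
    unit is a left unit itself, hence 1 or a unit; being invertible it can be
    cancelled, and the same applies to the remaining product. *)
Lemma opGL_opFR : opGL M `&` opFR M `<=` opG M.
Proof.
have [G1 GM] := opG_submonoid.
move=> x [Lx FRx]; suff: opFR M `<=` [set y | opGL M y -> opG M y] by apply.
apply: gen_sub => [|y [Ey|Ry] Ly].
- split=> //= y z IHy IHz Lyz.
  have Gz := IHz (opGL_mulr Lyz); apply: GM => //; apply: IHy.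
  (* Conjugating a y z = 1 by z, with z b = 1, gives z a y = 1. *)
  case: Gz => _ [b zb]; case: Lyz => a ayz; exists (z * a).
  by rewrite -[z * a * y]mulg1 -zb -!mulgA (mulgA y) (mulgA a) ayz mul1g.
- by rewrite (opE_opGL (conj Ey Ly)).
- by split.
Qed.

Lemma opGR_opFL : opGR M `&` opFL M `<=` opG M.
Proof.
have [G1 GM] := opG_submonoid.
move=> x [Rx FLx]; suff: opFL M `<=` [set y | opGR M y -> opG M y] by apply.
apply: gen_sub => [|y [Ey|Ly] Ry].
- split=> //= y z IHy IHz Ryz.
  have Gy := IHy (opGR_mull Ryz); apply: GM => //; apply: IHz.
  case: Gy => [[b by1] _]; case: Ryz => a yza; exists (a * y).
  rewrite -[z * _]mul1g -by1 -!mulgA (mulgA z) (mulgA y) (mulgA y z).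
  by rewrite yza mul1g.
- by rewrite (opE_opGR (conj Ey Ry)).
- by split.
Qed.

(** A one-sided inverse of a one-sided unit is a one-sided unit on the other
    side, so both families consist of units as soon as one of them does. *)
Lemma opG_eqLR : opG M = opGL M <-> opG M = opGR M.
Proof.
split=> eqG; apply/seteqP; split=> x; try by case.
- case=> a xa; have [_ [b ab]] : opG M a by rewrite eqG; exists x.
  split; [exists a | by exists a].
  by rewrite (inv_uniq xa ab).
- case=> a ax; have [[b ba] _] : opG M a by rewrite eqG; exists x.
  split; [by exists a | exists a].
  by rewrite -(inv_uniq ba ax).
Qed.

End Units.

(** * The operators on the submonoid generated by the one-sided units *)

Section Subs.
Context {M : monoidType}.
Implicit Types x y a : M.

Lemma opGL_opGLR : opGL M `<=` opGLR M.
Proof. by move=> x Lx; apply: sub_gen; left. Qed.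

Lemma opGR_opGLR : opGR M `<=` opGLR M.
Proof. by move=> x Rx; apply: sub_gen; right. Qed.

Lemma image_GLR_gen (A : set (GLR_monoid M)) :
  @GLR_val M @` gen A = gen (@GLR_val M @` A).
Proof. exact: image_gen. Qed.

Lemma image_GLR_opGL : @GLR_val M @` opGL (GLR_monoid M) = opGL M.
Proof.
apply/seteqP; split=> [_ [x [a ax] <-]|x Lx].
  by exists (GLR_val a); move: (congr1 (@GLR_val M) ax).
have GLRx := mem_set (opGL_opGLR Lx); case: Lx => a ax.
have Ra : opGR M a by exists x.
exists (GLRMonoid GLRx) => //; exists (GLRMonoid (mem_set (opGR_opGLR Ra))).
exact: val_inj.
Qed.

Lemma image_GLR_opGR : @GLR_val M @` opGR (GLR_monoid M) = opGR M.
Proof.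
apply/seteqP; split=> [_ [x [a xa] <-]|x Rx].
  by exists (GLR_val a); move: (congr1 (@GLR_val M) xa).
have GLRx := mem_set (opGR_opGLR Rx); case: Rx => a xa.
have La : opGL M a by exists x.
exists (GLRMonoid GLRx) => //; exists (GLRMonoid (mem_set (opGL_opGLR La))).
exact: val_inj.
Qed.

Lemma image_GLR_opG : @GLR_val M @` opG (GLR_monoid M) = opG M.
Proof.
rewrite /opG -image_GLR_opGL -image_GLR_opGR.
apply/seteqP; split=> [|_ [[x Lx <-] [y Ry /val_inj eyx]]].
  exact: sub_image_setI.
by exists x => //; split=> //; rewrite -eyx.
Qed.

Lemma subQE : subQ M = gen [set x | opGLR M x /\ x * x = x].
Proof.
rewrite /subQ /opE image_GLR_gen; congr gen.
apply/seteqP; split=> [_ [x xx <-]|x [GLRx xx]].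
  by split; [apply/set_mem/GLR_valP | move: (congr1 (@GLR_val M) xx)].
by exists (GLRMonoid (mem_set GLRx)) => //; apply: val_inj.
Qed.

Lemma subPE : subP M = gen (subQ M `|` opG M).
Proof. by rewrite /subP /opF image_GLR_gen image_setU image_GLR_opG. Qed.

Lemma subPLE : subPL M = gen (subQ M `|` opGL M).
Proof. by rewrite /subPL /opFL image_GLR_gen image_setU image_GLR_opGL. Qed.

Lemma subPRE : subPR M = gen (subQ M `|` opGR M).
Proof. by rewrite /subPR /opFR image_GLR_gen image_setU image_GLR_opGR. Qed.

Lemma subQ_opGLR : subQ M `<=` opGLR M.
Proof. by move=> _ [x _ <-]; apply/set_mem/GLR_valP. Qed.

Lemma subQ_opE : subQ M `<=` opE M.
Proof. by rewrite subQE; apply: gen_mono => x [_ xx]; apply: sub_gen. Qed.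

Lemma subQ1 : subQ M 1.
Proof. by rewrite subQE; apply: gen1. Qed.

End Subs.

(** * The collapsing types *)

Section Collapse.
Context {M : monoidType}.

Lemma latLplus_collapse :
  latL M (subQ M) -> latL M (subP M) -> latL M (subPL M) -> latL M (subPR M) ->
  latLplus M = latL M.
Proof.
move=> LQ LP LPL LPR; apply/seteqP; split=> [A [//|]|A]; last by left.
by move=> [[[->|->]|->]|->].
Qed.

Lemma collapse_opG : opG M = opGL M -> latLplus M = latL M.
Proof.
move=> GL; have GR : opG M = opGR M by apply/opG_eqLR.
have Gid : gen (opG M) = opG M by apply/gen_id/opG_submonoid.
have GLR : opGLR M = opG M by rewrite /opGLR -GL -GR setUid.
have Q1 : subQ M = [set 1].
  apply/seteqP; split=> x; last by move=> ->; apply: subQ1.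
  move=> Qx; apply: opE_opGL; split; first exact: subQ_opE.
  by rewrite -GL -GLR; apply: subQ_opGLR.
have P : gen (subQ M `|` opG M) = opG M.
  rewrite -[RHS]Gid; congr gen; apply/setUidPr; rewrite Q1 => _ ->.
  by case: (@opG_submonoid M).
apply: latLplus_collapse;
  rewrite ?subPE ?subPLE ?subPRE -?GL -?GR ?P ?Q1 /latL /=; tauto.
Qed.

Lemma opE_opGLR_collapse : opE M `<=` opGLR M -> subQ M = opE M.
Proof.
move=> EGLR; rewrite subQE; apply: gen_eq => x /=.
  by case=> _ xx; apply: sub_gen.
by move=> xx; apply: sub_gen; split=> //; apply: EGLR; apply: sub_gen.
Qed.

Lemma opFLR_opGLR : opFLR M = opGLR M <-> opE M `<=` opGLR M.
Proof.
split=> [<- x Ex|EGLR]; first by apply: sub_gen; left; left.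
apply: gen_eq => x.
  by case=> [[/EGLR//|Lx]|Rx]; [apply: opGL_opGLR | apply: opGR_opGLR].
by case=> Ux; apply: sub_gen; [left; right | right].
Qed.

Lemma collapse_opGLR : opFLR M = opGLR M -> latLplus M = latL M.
Proof.
move=> /opFLR_opGLR /opE_opGLR_collapse QE.
apply: latLplus_collapse; rewrite ?subPE ?subPLE ?subPRE QE /latL /=; tauto.
Qed.

End Collapse.

(** * The order on names *)

(** The members among G, Q, E, G_L, G_R, M that lie below a name in the
    reflexive-transitive closure of [covering]. *)
Definition hasG n := match n with n1 | nQ | nE => false | _ => true end.
Definition hasQ n := match n with n1 | nG | nGL | nGR => false | _ => true end.
Definition hasE n :=
  match n with nE | nF | nFL | nFR | nFLR | nM => true | _ => false end.
Definition hasGL n :=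
  match n with nGL | nPL | nGLR | nFL | nFLR | nM => true | _ => false end.
Definition hasGR n :=
  match n with nGR | nPR | nGLR | nFR | nFLR | nM => true | _ => false end.
Definition hasM n := match n with nM => true | _ => false end.

(** [j] drops the coordinate G and [i] drops the coordinate M; they stand for
    G being trivial and for F_LR = M. *)
Definition leN (i j : bool) (n m : name) : bool :=
  [&& j || (hasG n ==> hasG m), hasQ n ==> hasQ m, hasE n ==> hasE m,
      hasGL n ==> hasGL m, hasGR n ==> hasGR m & i || (hasM n ==> hasM m)].

(** The smaller name of each pair that [i] and [j] make coincide. *)
Definition reprN (i j : bool) (n : name) : name :=
  match n with
  | nG => if j then n1 else nG
  | nP => if j then nQ else nP
  | nF => if j then nE else nF
  | nM => if i then nFLR else nM
  | n => n
  end.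

(** Let [j] hold: a name with the coordinate G either is G, P or F, which get replaced, or
    has the coordinate G_L or G_R, so after the replacement G follows from the
    other coordinates. If [i] holds, no name is left with the coordinate M. *)
Lemma leN_repr i j n m :
  leN i j n m -> leN false false (reprN i j n) (reprN i j m).
Proof. by case: i j n m => [] [] [] []. Qed.

(** The coordinates Q, E, G_L, G_R alone separate all names except those in the
    four listed pairs. *)
Lemma leN_anti i j n m : leN i j n m -> leN i j m n ->
  n = m \/ coincidence n m \/ coincidence m n.
Proof.
case: i j n m => [] [] [] [] // _ _;
  by [left | right; left; constructor | right; right; constructor].
Qed.

Lemma leN_path n m : leN false false n m -> clos_refl_trans name covering n m.
Proof.
move=> le_nm; apply: clos_rt1n_rt.
by case: n m le_nm => [] [] //= _; eauto 10 using clos_refl_trans_1n, covering.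
Qed.

(** * Inclusions and separations *)

Section Denotations.
Context {M : monoidType}.

Lemma covering_subset n m : covering n m -> den M n `<=` den M m.
Proof.
have E1 : opE M 1 by apply: gen1.
have G1 : opG M 1 by case: (@opG_submonoid M).
case=> /=; rewrite ?subPE ?subPLE ?subPRE.
- by move=> x ->.
- by move=> x ->; apply: subQ1.
- exact: subQ_opE.
- by move=> x Qx; apply: sub_gen; left.
- by move=> x Ex; apply: sub_gen; left.
- exact: subIsetl.
- exact: subIsetr.
- by move=> x Gx; apply: sub_gen; right.
- by move=> x Lx; apply: sub_gen; right.
- by move=> x Rx; apply: sub_gen; right.
- by apply: gen_mono => x [Qx|[Lx _]]; apply: sub_gen; [left | right].
- by apply: gen_mono => x [Qx|[_ Rx]]; apply: sub_gen; [left | right].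
- by apply: gen_mono => x [/subQ_opE Ex|Gx]; apply: sub_gen; [left | right].
- by apply: gen_mono => x [/subQ_opGLR//|]; apply: opGL_opGLR.
- by apply: gen_mono => x [/subQ_opGLR//|]; apply: opGR_opGLR.
- by apply: gen_mono => x [/subQ_opE Ex|Lx]; apply: sub_gen; [left | right].
- by apply: gen_mono => x [/subQ_opE Ex|Rx]; apply: sub_gen; [left | right].
- by apply: gen_mono => x [Ex|[Lx _]]; apply: sub_gen; [left | right].
- by apply: gen_mono => x [Ex|[_ Rx]]; apply: sub_gen; [left | right].
- by apply: gen_mono => x [Ex|Lx]; apply: sub_gen; left; [left | right].
- by apply: gen_mono => x [Ex|Rx]; apply: sub_gen; [left; left | right].
- by apply: gen_mono => x [Lx|Rx]; apply: sub_gen; [left; right | right].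
- by [].
Qed.

Lemma leN_subset n m : leN false false n m -> den M n `<=` den M m.
Proof.
move=> /leN_path; elim=> [{}n {}m|{}n|n1' n2 n3 _ s12 _ s23].
- exact: covering_subset.
- by [].
- exact: subset_trans s23.
Qed.

Lemma opG_opE : opG M `<=` opE M -> opG M = [set 1].
Proof.
move=> GE; apply/seteqP; split=> [x Gx|_ ->].
  by apply: opE_opGL; split; [apply: GE | case: Gx].
by case: (@opG_submonoid M).
Qed.

Lemma opGL_sub_opFR : opGL M `<=` opFR M -> opG M = opGL M.
Proof.
move=> LF; apply/seteqP; split=> [|x Lx]; first exact: subIsetl.
by apply: opGL_opFR; split=> //; apply: LF.
Qed.

Lemma opGR_sub_opFL : opGR M `<=` opFL M -> opG M = opGL M.
Proof.
move=> RF; apply/opG_eqLR/seteqP; split=> [|x Rx]; first exact: subIsetr.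
by apply: opGR_opFL; split=> //; apply: RF.
Qed.

(** A left unit x with left inverse a yields the idempotent x a, a product of
    a left and a right unit, which equals 1 only if x is a unit. *)
Lemma subQ_trivial : subQ M `<=` [set 1] -> opG M = opGL M.
Proof.
move=> Q1; apply/seteqP; split=> [|x Lx]; first exact: subIsetl.
split=> //; have [a ax] := Lx; exists a; apply: Q1; rewrite subQE.
apply: sub_gen; split; last by rewrite mulgA -(mulgA x) ax mulg1.
by apply: genM; [apply: opGL_opGLR | apply: opGR_opGLR; exists x].
Qed.

Lemma subQ_sub_opGL : subQ M `<=` opGL M -> opG M = opGL M.
Proof.
move=> QL; apply: subQ_trivial => x Qx.
by apply: opE_opGL; split; [apply: subQ_opE | apply: QL].
Qed.

Lemma subQ_sub_opGR : subQ M `<=` opGR M -> opG M = opGL M.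
Proof.
move=> QR; apply: subQ_trivial => x Qx.
by apply: opE_opGR; split; [apply: subQ_opE | apply: QR].
Qed.

(** If n has a coordinate k that m lacks, then m lies below a name l maximal
    among those without the coordinate k, and the inclusion of n in m would
    give one of k in l, against the separation of k from l. *)
Lemma subset_leN (i j : bool) n m :
  opG M <> opGL M -> opFLR M <> opGLR M ->
  (opFLR M = setT -> i) -> (opG M = [set 1] -> j) ->
  den M n `<=` den M m -> leN i j n m.
Proof.
move=> GnL FnLR iP jP nm.
have chain k l : leN false false k n -> leN false false m l ->
    den M k `<=` den M l.
  move=> /leN_subset kn /leN_subset ml.
  exact: subset_trans (subset_trans kn nm) ml.
apply/and5P; split; last (apply/andP; split).
- case Gn: (hasG n); last by rewrite orbT.
  case Gm: (hasG m); first by rewrite orbT.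
  apply/orP; left; apply/jP/opG_opE.
  by apply: (chain nG nE); [case: n Gn {nm chain} | case: m Gm {nm chain}].
- apply/implyP=> Qn; apply/negPn/negP => Qm; apply: GnL.
  have [mL|mR] : leN false false m nGL \/ leN false false m nGR.
    by case: m Qm {nm chain} => //; auto.
    apply: subQ_sub_opGL; apply: (chain nQ nGL) => //.
    by case: n Qn {nm chain}.
  apply: subQ_sub_opGR; apply: (chain nQ nGR) => //.
  by case: n Qn {nm chain}.
- apply/implyP=> En; apply/negPn/negP => Em; apply: FnLR; apply/opFLR_opGLR.
  by apply: (chain nE nGLR); [case: n En {nm chain} | case: m Em {nm chain}].
- apply/implyP=> Ln; apply/negPn/negP => Lm; apply/GnL/opGL_sub_opFR.
  by apply: (chain nGL nFR); [case: n Ln {nm chain} | case: m Lm {nm chain}].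
- apply/implyP=> Rn; apply/negPn/negP => Rm; apply/GnL/opGR_sub_opFL.
  by apply: (chain nGR nFL); [case: n Rn {nm chain} | case: m Rm {nm chain}].
- case Mn: (hasM n); last by rewrite orbT.
  case Mm: (hasM m); first by rewrite orbT.
  apply/orP; left; apply: iP; apply/seteqP; split=> //.
  by apply: (chain nM nFLR); [case: n Mn {nm chain} | case: m Mm {nm chain}].
Qed.

Lemma den_F_E : den M nF = den M nE <-> opG M = [set 1].
Proof.
have Esub : is_submonoid (opE M) := gen_submonoid _.
split=> [FE|G1] /=.
  by apply: opG_opE; rewrite -[opE M]FE => x Gx; apply: sub_gen; right.
rewrite /opF G1 setUidl ?gen_id // => _ ->; exact: gen1.
Qed.

Lemma den_P_Q : den M nP = den M nQ <-> opG M = [set 1].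
Proof.
split=> [/= PQ|G1] /=.
  apply: opG_opE => x Gx; apply: subQ_opE; rewrite -PQ subPE.
  by apply: sub_gen; right.
have Qsub : is_submonoid (subQ M) by rewrite subQE; apply: gen_submonoid.
rewrite subPE G1 setUidl ?gen_id // => _ ->; exact: subQ1.
Qed.

Lemma den_repr (i j : bool) n :
  (i -> opFLR M = setT) -> (j -> opG M = [set 1]) ->
  den M (reprN i j n) = den M n.
Proof.
move=> iP jP; case: n => //=.
- by case: j jP => // ->.
- by case: j jP => // /(_ isT)/den_P_Q.
- by case: j jP => // /(_ isT)/den_F_E.
- by case: i iP => //= ->.
Qed.

Lemma latLplus_den A : latLplus M A -> exists n, A = den M n.
Proof.
rewrite /latLplus /latL /= => LA.
repeat case: LA => LA; rewrite LA;
  by [exists n1 | exists nE | exists nG | exists nGL | exists nGR | exists nGLR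
     | exists nF | exists nFL | exists nFR | exists nFLR | exists nM
     | exists nQ | exists nP | exists nPL | exists nPR].
Qed.

Lemma path_den n m :
  clos_refl_trans name covering n m ->
  clos_refl_trans (set M) (@base_incl M) (den M n) (den M m).
Proof.
elim=> [{}n {}m nm|{}n|n1' n2 n3 _ p12 _ p23].
- by apply: rt_step; exists n, m; split.
- exact: rt_refl.
- exact: rt_trans p23.
Qed.

Lemma base_incl_subset A B :
  clos_refl_trans (set M) (@base_incl M) A B -> A `<=` B.
Proof.
elim=> [_ _ [n [m [nm -> ->]]]|{}A|A1 A2 A3 _ s12 _ s23].
- exact: covering_subset.
- by [].
- exact: subset_trans s23.
Qed.

End Denotations.

Theorem mainTheorem6 (M : monoidType) :
  (forall t1 t2 t3 t4 : bool, typeT M = (t1, t2, t3, t4) ->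
     t1 = true \/ t3 = true -> latLplus M = latL M)
  /\
  (forall i j : bool, typeT M = (false, i, false, j) ->
     [/\ den M nM = den M nFLR <-> i = true,
         [/\ den M nG = den M n1 <-> j = true,
             den M nP = den M nQ <-> j = true
           & den M nF = den M nE <-> j = true],
         (forall n m : name, den M n = den M m ->
            n = m \/ coincidence n m \/ coincidence m n)
       & (forall A B : set M, latLplus M A -> latLplus M B ->
            (A `<=` B <-> clos_refl_trans (set M) (@base_incl M) A B))]).
Proof.
split=> [_ _ _ _ [<- _ <- _] [/asboolP|/asboolP]|i j [GL FLR GLR G1]].
- exact: collapse_opG.
- exact: collapse_opGLR.
have iP : opFLR M = setT <-> i = true.
  by rewrite -FLR; split=> /asboolP.
have jP : opG M = [set 1] <-> j = true.
  by rewrite -G1; split=> /asboolP.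
have nm_le n m : den M n `<=` den M m -> leN i j n m.
  apply: subset_leN; [exact/asboolPn/negbT | exact/asboolPn/negbT
                     | by move/iP | by move/jP].
split=> [||n m nm|A B].
- by rewrite -iP /=; split.
- by split; rewrite -jP //; [apply: den_P_Q | apply: den_F_E].
- by apply: (@leN_anti i j); apply: nm_le; rewrite nm.
- move=> /latLplus_den [n ->] /latLplus_den [m ->].
  split=> [/nm_le/leN_repr/leN_path/(@path_den M)|/base_incl_subset//].
  by rewrite !(den_repr _ (proj2 iP) (proj2 jP)).
Qed.
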